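(* Let $G=(V,E,w)$ be a finite weighted directed tree. Then for all $x,y\in V$ the function $q\mapsto U_q(x,y)$ is monotone non-decreasing on $(0,\infty)$.
   Context: A weighted directed graph $G=(V,E,w)$ has a finite vertex set $V$, a set $E\subseteq\{(x,y):x,y\in V\}$ of directed edges and a weight function $w:E\to[0,\infty)$. It is a weighted directed tree if its underlying undirected simple graph is a tree (each undirected edge may correspond to a directed edge in one or both directions, with possibly different weights). A rooted spanning forest of $G$ is a subset $F\subseteq E$ such that each vertex has at most one outgoing edge in $F$ and $F$ contains no directed cycle; its roots are the vertices without outgoing edge in $F$, $r(F)$ is the number of roots, and $\mathcal{F}$ is the set of rooted spanning forests. For $q>0$, $\Phi_q$ is the random rooted spanning forest with law $\mathbb{P}(\Phi_q=F)=q^{r(F)}w(F)/Z(q)$, $F\in\mathcal{F}$, with $w(F)=\prod_{e\in F}w(e)$ and $Z(q)=\sum_{F\in\mathcal{F}}q^{r(F)}w(F)$. $U_q(x,y)$ is the probability that $x$ and $y$ belong to different trees (connected components, ignoring orientation) of $\Phi_q$. *)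

(* Defs.v *)
From HB Require Import structures.
From mathcomp Require Import all_boot all_order all_algebra.
From mathcomp Require Import boolp reals.

Set Implicit Arguments.
Unset Strict Implicit.
Unset Printing Implicit Defensive.

Import Order.TTheory GRing.Theory Num.Theory.
Local Open Scope ring_scope.

(* The weight is a total function on ordered pairs; its values outside the edge
   set are unconstrained and never used. Self-loops are allowed. *)
Record wdigraph (R : realType) := WDigraph {
  vertex : finType;
  edges : {set vertex * vertex};
  weight : vertex * vertex -> R;
  weight_ge0 : forall e, e \in edges -> 0 <= weight e
}.

Definition directed (V : finType) (F : {set V * V}) : rel V :=
  fun x y => (x, y) \in F.

Definition undirected (V : finType) (F : {set V * V}) : rel V :=
  fun x y => [&& x != y & ((x, y) \in F) || ((y, x) \in F)].

(* [:: x; y] is a [ucycle] of any symmetric relation with x, y adjacent, so the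
   cycles of a simple graph are the [ucycle]s of size at least 3. *)
Definition is_tree (V : finType) (e : rel V) : Prop :=
  [/\ (0 < #|V|)%N,
      forall x y, connect e x y &
      forall c : seq V, ucycle e c -> (size c < 3)%N].

Definition is_directed_tree (R : realType) (G : wdigraph R) : Prop :=
  is_tree (undirected (edges G)).

Section RootedForests.
Variables (R : realType) (G : wdigraph R).
Implicit Types (F : {set vertex G * vertex G}) (q : R).

(* The directed cycles include loops and pairs of opposite edges. *)
Definition is_rooted_forest F : Prop :=
  [/\ F \subset edges G,
      forall x, (#|[set y | (x, y) \in F]| <= 1)%N &
      forall c : seq (vertex G), ucycle (directed F) c -> c = [::]].

Definition rooted_forests : {set {set vertex G * vertex G}} :=
  [set F | `[< is_rooted_forest F >]].

Definition roots F : {set vertex G} :=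
  [set x | [forall y, (x, y) \notin F]].

Definition forest_weight F : R := \prod_(e in F) weight e.

Definition partition_function q : R :=
  \sum_(F in rooted_forests) q ^+ #|roots F| * forest_weight F.

Definition forest_law q F : R :=
  q ^+ #|roots F| * forest_weight F / partition_function q.

Definition same_tree F : rel (vertex G) := connect (undirected F).

Definition separation_prob q (x y : vertex G) : R :=
  \sum_(F in rooted_forests | ~~ same_tree F x y) forest_law q F.

End RootedForests.

(* Main.v *)
Require Import Defs.
From mathcomp Require Import all_boot all_order all_algebra.
From mathcomp Require Import boolp reals.
From mathcomp Require Import lra.
Local Open Scope ring_scope.

(** Give every vertex [x] its own rate [t x], a forest having weight
    [\prod_(x in roots F) t x * forest_weight F]; the law in the theorem is the
    one with constant rate [q]. It is enough to show that raising a single rate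
    [t v] lowers the probability of [same_tree F x y], and then to raise the
    rates one vertex at a time ([event_prob_antitone]).

    Raising [t v] multiplies by a common factor the weights of the forests rooted
    at [v]. So the claim says that being rooted at [v] is negatively correlated
    with the event: the total weight of the pairs [(F, H)] with [F] in the event,
    [F] rooted at [v] and [H] not rooted at [v] is at most that of the pairs in
    which [F] is still in the event but [H] is the one rooted at [v]
    ([root_negative_correlation]).

    This is shown by an injection between the pairs. Follow from [v] the outgoing
    edges of [H] as long as [F] contains the reversed edge, and let [F] and [H]
    exchange the outgoing edges of the vertices met. The product of the weights is
    unchanged. The new [F] contains every edge of the old one, up to
    orientation, because the edges of [F] between the vertices met are replaced by
    their reversals in [H]; hence it is still in the event, which may be any event
    increasing in the undirected edges. The new pair determines the vertices met,
    so that the map is injective. Finally, in a directed tree the only possible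
    directed cycles are loops and pairs of opposite edges, and the exchange is cut
    exactly where it creates none. *)

Import Order.TTheory GRing.Theory Num.Theory.

Set Implicit Arguments.
Unset Strict Implicit.
Unset Printing Implicit Defensive.

Lemma prod_exchange (R : comPzRingType) (T : finType) (f : T -> R)
    (S A B A' B' : {set T}) :
    (forall x, (x \in A') = if x \in S then x \in B else x \in A) ->
    (forall x, (x \in B') = if x \in S then x \in A else x \in B) ->
  (\prod_(x in A') f x) * (\prod_(x in B') f x) =
  (\prod_(x in A) f x) * (\prod_(x in B) f x).
Proof.
move=> hA hB; rewrite ![\prod_(_ in _) _]big_mkcond -!big_split /=.
by apply: eq_bigr => x _; rewrite hA hB; case: (x \in S); rewrite 1?mulrC.
Qed.

Lemma ler_sum_inj (R : numDomainType) (T : finType) (P Q : pred T)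
    (W : T -> R) (f : T -> T) :
    {in P &, injective f} -> (forall p, P p -> Q (f p)) ->
    (forall p, P p -> W (f p) = W p) -> (forall p, Q p -> 0 <= W p) ->
  \sum_(p | P p) W p <= \sum_(p | Q p) W p.
Proof.
move=> finj fPQ fW W0.
have setE (X : pred T) : \sum_(p | X p) W p = \sum_(p in [set p | X p]) W p.
  by apply: eq_bigl => p; rewrite inE.
have -> : \sum_(p | P p) W p = \sum_(p in f @: P) W p.
  by rewrite big_imset //; apply: eq_bigr => p Pp; rewrite fW.
rewrite [leRHS]setE [leRHS](big_setID (f @: P)) /=.
have sPQ : f @: P \subset [set p | Q p].
  by apply/subsetP => _ /imsetP[p Pp ->]; rewrite inE; apply: fPQ.
by rewrite (setIidPr sPQ) lerDl; apply: sumr_ge0 => p; rewrite !inE => /andP[_ /W0].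
Qed.

(** * Exchanging outgoing edges *)

Section Exchange.
Variable V : finType.
Implicit Types (F H : {set V * V}) (S : {set V}) (v x y : V).

Definition functional F := forall x y z, (x, y) \in F -> (x, z) \in F -> y = z.

Definition antisymmetric_edges F := forall x y, (x, y) \in F -> (y, x) \notin F.

Definition glue S F H : {set V * V} :=
  [set e | if e.1 \in S then e \in F else e \in H].

Lemma in_glue S F H x y :
  ((x, y) \in glue S F H) = if x \in S then (x, y) \in F else (x, y) \in H.
Proof. by rewrite inE. Qed.

Lemma glueK S F H : glue S (glue S F H) (glue S H F) = F.
Proof. by apply/setP => -[x y]; rewrite !in_glue; case: (x \in S). Qed.

Definition opposed F H : rel V := fun x y => ((x, y) \in H) && ((y, x) \in F).

(** The part, followed from [v], of the path of outgoing edges of [H] that [F]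
    traverses backwards. It is encoded as a reachability set, so that no path has
    to be carried along. *)
Definition opposed_path v F H : {set V} := [set x | connect (opposed F H) v x].

Lemma opposed_path_start v F H : v \in opposed_path v F H.
Proof. by rewrite inE. Qed.

Lemma opposed_path_step v F H x y :
  x \in opposed_path v F H -> (x, y) \in H -> (y, x) \in F ->
  y \in opposed_path v F H.
Proof.
by rewrite !inE => vx xy yx; apply/(connect_trans vx)/connect1/andP.
Qed.

(** A vertex of the path other than [v] was entered along an edge of [H] whose
    reversal is its only outgoing edge in [F]; and [v] has none. *)
Lemma opposed_path_back v F H x y :
    functional F -> (forall z, (v, z) \notin F) ->
    x \in opposed_path v F H -> (x, y) \in F ->
  y \in opposed_path v F H /\ (y, x) \in H.
Proof.
move=> Ffun vroot; rewrite inE => /connectP[p].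
case/lastP: p => [_ -> /= vy|p z]; first by move: (vroot y); rewrite vy.
rewrite rcons_path last_rcons => /andP[vp /andP[lz zl]] -> zy.
rewrite (Ffun _ _ _ zy zl); split=> //.
by rewrite inE; apply/connectP; exists p.
Qed.

Definition exchange v (p : {set V * V} * {set V * V}) :=
  let S := opposed_path v p.1 p.2 in (glue S p.2 p.1, glue S p.1 p.2).

(** The exchanged pair, taken in the other order, agrees with [(F, H)] on the path,
    so it traverses the path again. It cannot continue further: a step
    leaving the path would use two opposite edges of [H]. Together with [glueK]
    this makes the exchange invertible. *)
Lemma opposed_path_exchange v F H : antisymmetric_edges H ->
  let S := opposed_path v F H in
  opposed_path v (glue S F H) (glue S H F) = S.
Proof.
move=> Hanti S; apply/setP => x; apply/idP/idP => [|xS].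
  rewrite inE => /connectP[p].
  elim/last_ind: p x => [|p z IH] x.
    by move=> _ ->; apply: opposed_path_start.
  rewrite rcons_path last_rcons => /andP[vp /andP[+ +]] ->.
  have lS := IH _ vp erefl; rewrite !in_glue lS => lz.
  case: ifP => // zS zl.
  by move: (Hanti _ _ lz); rewrite zl.
move: (xS); rewrite [_ \in S]inE => /connectP[p].
elim/last_ind: p x {xS} => [|p z IH] x.
  by move=> _ ->; apply: opposed_path_start.
rewrite rcons_path last_rcons => /andP[vp /andP[lz zl]] ->.
have lS : last v p \in S by rewrite inE; apply/connectP; exists p.
have zS : z \in S by exact: opposed_path_step lz zl.
by apply: opposed_path_step (IH _ vp erefl) _ _; rewrite in_glue ?lS ?zS.
Qed.

Lemma exchange_inj v F1 H1 F2 H2 :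
    antisymmetric_edges H1 -> antisymmetric_edges H2 ->
  exchange v (F1, H1) = exchange v (F2, H2) -> (F1, H1) = (F2, H2).
Proof.
move=> a1 a2; rewrite /exchange /=.
have := @opposed_path_exchange v F1 _ a1.
have := @opposed_path_exchange v F2 _ a2.
set S1 := opposed_path v F1 H1; set S2 := opposed_path v F2 H2 => /=.
move=> e2 e1 [eF eH]; have eS : S1 = S2 by rewrite -e1 -e2 eF eH.
congr (_, _).
  by rewrite -(glueK S1 F1 H1) eF eH eS glueK.
by rewrite -(glueK S1 H1 F1) eF eH eS glueK.
Qed.

Lemma functional_glue S F H :
  functional F -> functional H -> functional (glue S F H).
Proof.
by move=> f h x y z; rewrite !in_glue; case: ifP => _; [exact: f|exact: h].
Qed.

(** An opposite pair in a glued set has to cross the boundary of [S]. *)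
Lemma antisymmetric_glue S F H :
    antisymmetric_edges F -> antisymmetric_edges H ->
    (forall x y, x \in S -> (x, y) \in F -> (y, x) \in H -> y \in S) ->
  antisymmetric_edges (glue S F H).
Proof.
move=> aF aH cross x y; rewrite !in_glue.
case: ifP => xS; case: ifP => yS xy.
- exact: aF.
- by apply/negP => yx; rewrite (cross x y) in yS.
- by apply/negP => yx; rewrite (cross y x) in xS.
- exact: aH.
Qed.

(** Inside the path each edge of [F] becomes its reversal in [H], and no edge of
    [F] leaves the path; this is why connections in [F] survive. *)
Lemma subrel_undirected_exchange v F H :
    functional F -> (forall z, (v, z) \notin F) ->
  subrel (undirected F) (undirected (exchange v (F, H)).1).
Proof.
move=> Ffun vroot.
suff key x y : (x, y) \in F ->
    ((x, y) \in (exchange v (F, H)).1) || ((y, x) \in (exchange v (F, H)).1).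
  move=> x y /andP[xy /orP[] /key e]; rewrite /undirected xy //=.
  by rewrite orbC.
move=> xy; rewrite !in_glue /=; case: ifP => xS; last by rewrite xy.
by have [-> ->] := opposed_path_back Ffun vroot xS xy; rewrite orbT.
Qed.

End Exchange.

(** * Rooted forests with vertex-dependent rates *)

Section Rates.
Variables (R : realType) (G : wdigraph R).
Local Notation V := (vertex G).
Local Notation roots := Defs.roots.
Implicit Types (F H : {set V * V}) (v : V) (t : V -> R).

Lemma functionalP F :
  functional F <-> forall x, (#|[set y | (x, y) \in F]| <= 1)%N.
Proof.
split=> [f x|h x y z xy xz].
  by apply/card_le1_eqP => y z; rewrite !inE => xy xz; apply: f xz xy.
by move/card_le1_eqP: (h x); apply; rewrite inE.
Qed.

(** In a directed tree there is no room for a directed cycle of length at least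
    three, so acyclicity becomes a condition on pairs of edges. *)
Lemma rooted_forestsP (hG : is_directed_tree G) F :
  (F \in rooted_forests G) <->
  [/\ F \subset edges G, functional F & antisymmetric_edges F].
Proof.
rewrite inE; split.
  move=> /asboolP[sF /functionalP fF acyc]; split=> // x y xy.
  apply/negP => yx; have [e|ne] := eqVneq x y.
    suff: [:: x] = [::] by [].
    by apply: acyc; rewrite /ucycle /= /directed andbT {2}e xy.
  suff: [:: x; y] = [::] by [].
  by apply: acyc; rewrite /ucycle /= /directed xy yx inE ne.
case=> sF fF aF; apply/asboolP; split=> // [|c]; first exact/functionalP.
case: hG => _ _ tree; have noloop x y : (x, y) \in F -> x != y.
  by move=> xy; apply/eqP => e; move: (aF _ _ xy); rewrite e in xy *; rewrite xy.
have [|big] := leqP (size c) 2.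
  case: c => [|x [|y [|//]]] //= _; rewrite /ucycle /= /directed.
    by case/andP => /andP[/noloop/eqP].
  by case/andP => /and3P[xy yx _] _; move: (aF _ _ xy); rewrite yx.
case/andP => cyc unc.
suff /tree : ucycle (undirected (edges G)) c by rewrite ltnNge big.
rewrite /ucycle unc andbT; apply: sub_cycle cyc => x y xy.
by rewrite /undirected (noloop _ _ xy) (subsetP sF _ xy).
Qed.

Definition rate_weight t F : R := \prod_(x in roots F) t x * forest_weight F.

Definition event_weight (A : pred {set V * V}) t : R :=
  \sum_(F in rooted_forests G | A F) rate_weight t F.

Definition increasing (A : pred {set V * V}) :=
  forall F H, subrel (undirected F) (undirected H) -> A F -> A H.

Lemma in_roots F x : reflect (forall y, (x, y) \notin F) (x \in roots F).
Proof. by rewrite inE; apply: forallP. Qed.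

Lemma roots_glue (S : {set V}) F H x :
  (x \in roots (glue S F H)) = if x \in S then x \in roots F else x \in roots H.
Proof.
by case: ifP => xS; rewrite !inE; apply: eq_forallb => y; rewrite in_glue xS.
Qed.

Lemma rate_weight_ge0 t F :
    (forall x, 0 < t x) -> F \in rooted_forests G -> 0 <= rate_weight t F.
Proof.
rewrite inE => t0 /asboolP[/subsetP sF _ _].
apply: mulr_ge0; apply: prodr_ge0 => e; first by rewrite ltW.
by move/sF/weight_ge0.
Qed.

Lemma rate_weight_exchange t v F H :
  rate_weight t (exchange v (F, H)).1 * rate_weight t (exchange v (F, H)).2 =
  rate_weight t F * rate_weight t H.
Proof.
rewrite /rate_weight mulrACA [RHS]mulrACA; congr (_ * _).
  by apply: prod_exchange => x; rewrite roots_glue.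
rewrite /forest_weight.
pose S := [set e : V * V | e.1 \in opposed_path v F H].
by apply: (@prod_exchange _ _ _ S) => -[x y]; rewrite in_glue [_ \in S]inE.
Qed.

(** The two halves avoid opposite pairs for different reasons: in the first, an
    opposite pair would be a further step of the path; in the second, it would
    start with an edge of [F] leaving the path, which does not exist as [F] is
    rooted at [v]. *)
Lemma rooted_forests_exchange (hG : is_directed_tree G) v F H :
    F \in rooted_forests G -> H \in rooted_forests G -> v \in roots F ->
  (exchange v (F, H)).1 \in rooted_forests G /\
  (exchange v (F, H)).2 \in rooted_forests G.
Proof.
move=> /(rooted_forestsP hG)[sF fF aF] /(rooted_forestsP hG)[sH fH aH].
move=> /in_roots vroot.
have sub S (A B : {set V * V}) :
    A \subset edges G -> B \subset edges G -> glue S A B \subset edges G.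
  move=> /subsetP sA /subsetP sB; apply/subsetP => -[x y].
  by rewrite in_glue; case: ifP => _; [move/sA|move/sB].
split; apply/(rooted_forestsP hG); split; try exact: sub; try exact: functional_glue.
- apply: antisymmetric_glue => // x y; exact: opposed_path_step.
- apply: antisymmetric_glue => // x y xS xy _.
  by have [] := opposed_path_back fF vroot xS xy.
Qed.

(** Both sides are sums over pairs of forests, and [exchange v] injects the pairs
    on the left into those on the right: it moves the root [v] from the first
    forest to the second and keeps the first one in [A]. *)
Lemma root_negative_correlation (hG : is_directed_tree G) (A : pred {set V * V})
    t v : increasing A -> (forall x, 0 < t x) ->
  event_weight (fun F => A F && (v \in roots F)) t *
    event_weight (fun F => v \notin roots F) t <=
  event_weight (fun F => A F && (v \notin roots F)) t *
    event_weight (fun F => v \in roots F) t.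
Proof.
move=> incA t0; rewrite /event_weight !big_distrlr /= !pair_big /=.
apply: (ler_sum_inj (f := exchange v)).
- move=> [F1 H1] [F2 H2].
  move=> /andP[_ /andP[/(rooted_forestsP hG)[_ _ a1] _]].
  move=> /andP[_ /andP[/(rooted_forestsP hG)[_ _ a2] _]].
  exact: exchange_inj.
- move=> [F H] /= /andP[/and3P[OF AF vF] /andP[OH vH]].
  have [-> ->] := rooted_forests_exchange hG OF OH vF.
  rewrite !roots_glue opposed_path_start vH vF !andbT /=.
  apply: incA AF; apply: subrel_undirected_exchange; last exact/in_roots.
  by case/(rooted_forestsP hG): OF.
- by move=> [F H] _; exact: rate_weight_exchange.
- by move=> [F H] /andP[/and3P[OF _ _] /andP[OH _]];
    apply: mulr_ge0; apply: rate_weight_ge0.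
Qed.

(** The forest without edges has positive weight, whatever the edge weights. *)
Lemma event_weight_gt0 t : (forall x, 0 < t x) -> 0 < event_weight predT t.
Proof.
move=> t0; have O0 : set0 \in rooted_forests G.
  rewrite inE; apply/asboolP; split; first exact: sub0set.
    by move=> x; rewrite eq_card0 // => y; rewrite !inE.
  by case=> [//|x [|y c]] /=; rewrite /ucycle /= /directed inE.
rewrite /event_weight (bigD1 set0) /=; last by rewrite O0.
apply: ltr_pwDl; last first.
  by apply: sumr_ge0 => F /andP[/andP[? _] _]; apply: rate_weight_ge0.
rewrite /rate_weight /forest_weight big_set0 mulr1; exact: prodr_gt0.
Qed.

Lemma event_weight_root_split (A : pred {set V * V}) t v :
  event_weight A t = event_weight (fun F => A F && (v \notin roots F)) t +
                     event_weight (fun F => A F && (v \in roots F)) t.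
Proof.
rewrite /event_weight (bigID (fun F => v \in roots F)) /= addrC.
by congr (_ + _); apply: eq_bigl => F; rewrite andbA.
Qed.

Section OneRate.
Variables (t t' : V -> R) (v : V).
Hypothesis t0 : forall x, 0 < t x.
Hypothesis tt' : forall x, x != v -> t' x = t x.

Lemma event_weight_nonroot (A : pred {set V * V}) :
  event_weight (fun F => A F && (v \notin roots F)) t' =
  event_weight (fun F => A F && (v \notin roots F)) t.
Proof.
apply: eq_bigr => F /and3P[_ _ vF]; congr (_ * _).
by apply: eq_bigr => x xF; apply: tt'; apply: contraNneq vF => <-.
Qed.

Lemma event_weight_root (A : pred {set V * V}) :
  event_weight (fun F => A F && (v \in roots F)) t' =
  t' v / t v * event_weight (fun F => A F && (v \in roots F)) t.
Proof.
rewrite /event_weight mulr_sumr; apply: eq_bigr => F /and3P[_ _ vF].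
rewrite /rate_weight (bigD1 v) //= [in RHS](bigD1 v) //= !mulrA.
rewrite divfK ?gt_eqF //; congr (_ * _ * _).
by apply: eq_bigr => x /andP[_ xv]; rewrite tt'.
Qed.

(** Only the forests rooted at [v] are rescaled, by [r = t' v / t v]. After
    clearing denominators and cancelling common terms, the inequality is
    [root_negative_correlation] multiplied by [r - 1]. *)
Lemma event_prob_antitone1 (hG : is_directed_tree G) (A : pred {set V * V}) :
    increasing A -> t v <= t' v ->
  event_weight A t' / event_weight predT t' <=
  event_weight A t / event_weight predT t.
Proof.
move=> incA tv.
have t'0 x : 0 < t' x.
  by have [->|/tt' ->] := eqVneq x v; first exact: lt_le_trans tv.
rewrite ler_pdivrMr ?event_weight_gt0 // mulrAC ler_pdivlMr ?event_weight_gt0 //.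
have split_v := event_weight_root_split _ _ v.
rewrite (split_v A t') (split_v predT t') (split_v A t) (split_v predT t).
rewrite !event_weight_nonroot !event_weight_root.
have := root_negative_correlation hG v incA t0.
have : 1 <= t' v / t v by rewrite ler_pdivlMr // mul1r.
set a := event_weight (fun F => A F && (v \notin roots F)) t.
set b := event_weight (fun F => A F && (v \in roots F)) t.
rewrite /=.
set c := event_weight (fun F => v \notin roots F) t.
set d := event_weight (fun F => v \in roots F) t.
move: (t' v / t v) => r; rewrite -subr_ge0 => r1.
rewrite -subr_ge0 => /(mulr_ge0 r1) corr; lra.
Qed.

End OneRate.

(** Rates that differ at many vertices are joined by raising them one by one, along
    the enumeration of the vertices. *)
Lemma event_prob_antitone (hG : is_directed_tree G) (A : pred {set V * V}) t t' :
    increasing A -> (forall x, 0 < t x) -> (forall x, t x <= t' x) ->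
  event_weight A t' / event_weight predT t' <=
  event_weight A t / event_weight predT t.
Proof.
move=> incA t0 tt'.
pose mix (s : seq V) x := if x \in s then t' x else t x.
have -> : t' = mix (enum V) by apply/funext => x; rewrite /mix mem_enum.
have mix0 s x : 0 < mix s x.
  by rewrite /mix; case: ifP => _ //; apply: lt_le_trans (tt' x).
elim: (enum V) => [|v s IH]; first by have -> : mix [::] = t by apply/funext.
apply: le_trans IH; apply: (@event_prob_antitone1 _ _ v) => //.
  by move=> x xv; rewrite /mix inE (negbTE xv).
by rewrite /mix mem_head; case: ifP.
Qed.

Lemma increasing_same_tree (x y : V) : increasing (fun F => same_tree F x y).
Proof.
by move=> F H sFH; apply: connect_sub => a b /sFH; exact: connect1.
Qed.

Lemma rate_weight_cst q F :
  rate_weight (fun=> q) F = q ^+ #|roots F| * forest_weight F.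
Proof. by rewrite /rate_weight prodr_const. Qed.

Lemma separation_probE q (x y : V) : 0 < q ->
  separation_prob q x y =
  1 - event_weight (fun F => same_tree F x y) (fun=> q) /
      event_weight predT (fun=> q).
Proof.
move=> q0; have Z0 := event_weight_gt0 (fun=> q0).
have Zq : partition_function G q = event_weight predT (fun=> q).
  rewrite /event_weight big_andbC /=.
  by apply: eq_bigr => F _; rewrite rate_weight_cst.
rewrite -[X in X - _](divff (lt0r_neq0 Z0)) -mulrBl /separation_prob.
rewrite /forest_law Zq -mulr_suml; congr (_ / _).
apply/eqP; rewrite eq_sym subr_eq addrC; apply/eqP.
rewrite -Zq /partition_function (bigID (fun F => same_tree F x y)) /=.
by congr (_ + _); apply: eq_bigr => F _; rewrite rate_weight_cst.
Qed.

End Rates.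

Theorem theorem3 (R : realType) (G : wdigraph R) (hG : is_directed_tree G)
    (x y : vertex G) (q1 q2 : R) (hq1 : 0 < q1) (hq12 : q1 <= q2) :
  separation_prob q1 x y <= separation_prob q2 x y.
Proof.
rewrite !separation_probE ?(lt_le_trans hq1) // lerD2l lerN2.
by apply: event_prob_antitone => //; exact: increasing_same_tree.
Qed.
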